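(* For every fixed integer $d\ge 1$, the discretization error $$E(N,d)=\sum_{\ell\in\mathbb{N}_0^d,\ |\ell|>N}2^{-\sum_{\ell_i\neq 0}(\ell_i+1)}$$ of the $N$-th level sparse basis has, as a function of $N\in\mathbb{N}$, the leading order term $$E(N,d)\;\doteq\;\frac{N^{d-1}\,2^{-N-d}}{(d-1)!},$$ i.e. $$\lim_{N\to\infty}\frac{E(N,d)\,(d-1)!}{N^{d-1}\,2^{-N-d}}=1 .$$
   Context: For a multiindex $\ell=(\ell_1,\ldots,\ell_d)\in\mathbb{N}_0^d$ (with $\mathbb{N}_0=\{0,1,2,\ldots\}$), $|\ell|=\ell_1+\cdots+\ell_d$. The inner sum $\sum_{\ell_i\ne0}(\ell_i+1)$ runs over those $i\in\{1,\ldots,d\}$ with $\ell_i\neq 0$ (an empty sum is $0$). The symbol $\doteq$ denotes equality of the leading order term in $N$ (with $d$ fixed). *)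

(* Defs.v *)
From mathcomp Require Import all_boot all_order all_algebra.
From mathcomp Require Import all_classical all_reals all_analysis.

Set Implicit Arguments.
Unset Strict Implicit.
Unset Printing Implicit Defensive.

Import Order.TTheory GRing.Theory Num.Theory.
Import numFieldNormedType.Exports.

Local Open Scope classical_set_scope.
Local Open Scope ring_scope.

Definition mi_size (d : nat) (l : {ffun 'I_d -> nat}) : nat :=
  (\sum_(i < d) l i)%N.

Definition mi_weight (d : nat) (l : {ffun 'I_d -> nat}) : nat :=
  (\sum_(i < d | l i != 0) (l i + 1))%N.

(* The sum over infinitely many multiindices is the unordered sum of
   nonnegative terms, a priori valued in [0, +oo]. *)
Definition disc_error (R : realType) (N d : nat) : \bar R :=
  \esum_(l in [set l : {ffun 'I_d -> nat} | (N < mi_size l)%N])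
    ((2 : R) ^- mi_weight l)%:E.

(* Main.v *)
Require Import Defs.
From mathcomp Require Import all_boot all_order all_algebra.
From mathcomp Require Import all_classical all_reals all_analysis.
From mathcomp Require Import zify ring.

Import Order.TTheory GRing.Theory Num.Theory.
Import numFieldNormedType.Exports.

Local Open Scope classical_set_scope.
Local Open Scope ring_scope.

(** Write T(d, m) for the sum of 2^(- weight) over the multiindices of dimension
    d and size at least m, so that the discretization error is
    E(N, d) = T(d, N + 1).

    Both size and weight are additive over the entries, so splitting off the
    first entry k turns T into a convolution (lemma [size_tailS]):
    T(d + 1, m) = sum over k of 2^(- w(k)) T(d, m - k), where w(0) = 0,
    w(k) = k + 1 for k > 0, and the truncated subtraction m - k covers the
    entries k >= m, for which the remaining entries are unconstrained.  For those
    k the factor T(d, 0) = (3/2)^d is constant and the series is geometric.  After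
    rescaling by e_d(N) = 2^(N + d) E(N, d), every power of 2 cancels and what is
    left is a finite recursion over the natural numbers (lemma [size_tailE]):
    e_(d+1)(N) = 2 e_d(N) + sum_(j < N) e_d(j) + 3^d, with e_0 = 0.

    Summation over j < N sends the binomial C(j, k) to C(N, k + 1), so by
    induction e_d is a combination of C(N, 0), ..., C(N, d - 1)
    (lemma [scaled_tailE]).  The top coefficient starts at 1 and is only ever
    shifted, hence stays 1 (lemma [tail_coef_lead]).  Since C(N, k) / N^k tends
    to 1 / k!, the term C(N, d - 1) dominates and e_d(N) is equivalent to
    N^(d-1) / (d-1)!, which is the claim. *)

(** * Two facts on sums of nonnegative extended reals *)

(** Scaling the finite subsums gives one inequality, for every positive scalar;
    the other is the same inequality for the inverse scalar. *)
Lemma esum_pZl (R : realType) (T : choiceType) (I : set T) (x : R)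
    (f : T -> \bar R) :
  0 < x -> (forall i, (0 <= f i)%E) ->
  (\esum_(i in I) (x%:E * f i) = x%:E * \esum_(i in I) f i)%E.
Proof.
have le_esumZ y (g : T -> \bar R) : 0 < y -> (forall i, (0 <= g i)%E) ->
    (\esum_(i in I) (y%:E * g i) <= y%:E * \esum_(i in I) g i)%E.
  move=> y0 g0; apply: ge_ereal_sup => _ [X IX <-].
  rewrite -ge0_mule_fsumr// lee_pmul2l//.
  by apply: esum_ge; exists X.
move=> x0 f0; apply/eqP; rewrite eq_le le_esumZ//=.
rewrite -lee_pdivlMl//.
rewrite [leLHS](_ : _ = \esum_(i in I) (x^-1%:E * (x%:E * f i)))%E; last first.
  by apply: eq_esum => i _; rewrite muleA -EFinM mulVf ?gt_eqF// mul1e.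
by apply: le_esumZ => [|i]; rewrite ?invr_gt0// mule_ge0// lee_fin ltW.
Qed.

Lemma nneseries_half_tail (R : realType) (m : nat) :
  (\sum_(m <= k <oo) (2 ^- k.+1 : R)%:E = (2 ^- m)%:E)%E.
Proof.
rewrite -nneseries_addn; last by move=> k; rewrite lee_fin invr_ge0 exprn_ge0.
apply/cvg_lim => //.
have := @cvg_geometric_eseries_half R 1 m; rewrite div1r.
by under eq_fun do rewrite natrX div1r addnS.
Qed.

(** * Splitting off the first entry of a multiindex *)

Definition cons_mi (d : nat) (p : nat * {ffun 'I_d -> nat}) :
    {ffun 'I_d.+1 -> nat} :=
  [ffun i => if unlift ord0 i is Some j then p.2 j else p.1].

Definition entry_weight (k : nat) : nat := if k == 0%N then 0%N else k.+1.

Lemma cons_mi_bij (d : nat) : bijective (@cons_mi d).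
Proof.
exists (fun l : {ffun 'I_d.+1 -> nat} =>
  (l ord0, [ffun j : 'I_d => l (lift ord0 j)])) => [[k l]|l].
  rewrite /cons_mi /= ffunE unlift_none; congr pair.
  by apply/ffunP => j; rewrite !ffunE liftK.
apply/ffunP => i; rewrite ffunE /=.
by case: unliftP => [j ->|->]; rewrite ?ffunE.
Qed.

Lemma mi_size_cons (d k : nat) (l : {ffun 'I_d -> nat}) :
  mi_size (cons_mi d (k, l)) = (k + mi_size l)%N.
Proof.
rewrite /mi_size big_ord_recl ffunE unlift_none; congr addn.
by apply: eq_bigr => j _ /=; rewrite ffunE liftK.
Qed.

Lemma mi_weight_cons (d k : nat) (l : {ffun 'I_d -> nat}) :
  mi_weight (cons_mi d (k, l)) = (entry_weight k + mi_weight l)%N.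
Proof.
rewrite /mi_weight big_mkcond [in RHS]big_mkcond/= big_ord_recl ffunE unlift_none.
congr addn; first by rewrite /entry_weight addn1; case: eqP.
by apply: eq_bigr => j _ /=; rewrite ffunE liftK.
Qed.

Definition size_tail (R : realType) (d m : nat) : \bar R :=
  \esum_(l in [set l : {ffun 'I_d -> nat} | (m <= mi_size l)%N])
    ((2 : R) ^- mi_weight l)%:E.

Lemma pow2V_ge0 (R : realType) (n : nat) : (0 <= (2 ^- n : R)%:E)%E.
Proof. by rewrite lee_fin invr_ge0 exprn_ge0. Qed.

Lemma size_tail_ge0 (R : realType) (d m : nat) : (0 <= size_tail R d m)%E.
Proof. by apply: esum_ge0 => l _; exact: pow2V_ge0. Qed.

(** Prepending an entry is a bijection under which size and weight add up; the
    truncated subtraction makes the constraint on the remaining entries void as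
    soon as the first entry reaches m. *)
Lemma size_tailS (R : realType) (d m : nat) :
  (size_tail R d.+1 m =
   \sum_(0 <= k <oo) (2 ^- entry_weight k)%:E * size_tail R d (m - k))%E.
Proof.
rewrite nneseries_esumT; last first.
  by move=> k; rewrite mule_ge0 ?pow2V_ge0 ?size_tail_ge0.
rewrite (eq_esum (b := fun k =>
  \esum_(l in [set l : {ffun 'I_d -> nat} | (m - k <= mi_size l)%N])
    ((2 ^- entry_weight k)%:E * (2 ^- mi_weight l)%:E)%E)); last first.
  by move=> k _; rewrite esum_pZl ?invr_gt0 ?exprn_gt0.
rewrite /= esum_esum; last first.
  by move=> k l _ _; rewrite mule_ge0 ?pow2V_ge0.
rewrite /size_tail (@reindex_esum _ _ _
  (setT `*`` (fun k => [set l | (m - k <= mi_size l)%N])) _ (@cons_mi d)).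
  apply: eq_esum => -[k l] _ /=.
  by rewrite mi_weight_cons exprD invfM EFinM.
split.
- by move=> [k l] /= [_]; rewrite mi_size_cons leq_subLR.
- by move=> p q _ _; apply: bij_inj; exact: cons_mi_bij.
- have [uncons _ consK] := cons_mi_bij d.
  move=> l /= m_le; exists (uncons l); rewrite ?consK//.
  by move: m_le; rewrite -{1}(consK l); case: (uncons l) => k l' /=;
    rewrite mi_size_cons leq_subLR.
Qed.

(** * The rescaled error as a natural number *)

(** This is 2^(N + d) E(N, d). The term 3^d' collects all the first entries
    k > N: they contribute (3/2)^d' 2^(- (N + 1)) to the error in dimension
    d' + 1, which is rescaled by 2^(N + d' + 1). *)
Fixpoint scaled_tail (d N : nat) : nat :=
  if d is d'.+1 then
    (2 * scaled_tail d' N + \sum_(j < N) scaled_tail d' j + 3 ^ d')%N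
  else 0%N.

Lemma scaled_tailS (d N : nat) :
  scaled_tail d.+1 N =
    (2 * scaled_tail d N + \sum_(j < N) scaled_tail d j + 3 ^ d)%N.
Proof. by []. Qed.

(** The value at m = 0 is the total mass, the d-th power of 1 + 1/4 + 1/8 + ...
    = 3/2; it has to be carried along in the induction because it is the common
    factor of all the terms with a large first entry. *)
Lemma size_tailE (R : realType) (d m : nat) :
  size_tail R d m =
  (if m is N.+1 then (scaled_tail d N)%:R / 2 ^+ (N + d) else (3 / 2) ^+ d)%:E.
Proof.
elim: d m => [|d IHd] m.
  have all0 (l : {ffun 'I_0 -> nat}) : l = [ffun=> 0%N] by apply/ffunP => -[].
  case: m => [|N] /=.
    rewrite /size_tail (_ : [set l | _] = [set [ffun=> 0%N]]).
      rewrite esum_set1 ?pow2V_ge0//.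
      by rewrite /mi_weight big_ord0 expr0 invr1.
    by apply/seteqP; split => l //= _; exact: all0.
  rewrite /size_tail (_ : [set l | _] = set0) ?esum_set0 ?mul0r//.
  by apply/seteqP; split => l //=; rewrite /mi_size big_ord0.
have term_ge0 k : (0 <= (2 ^- entry_weight k)%:E * size_tail R d (m - k))%E.
  by rewrite mule_ge0 ?pow2V_ge0 ?size_tail_ge0.
have far_terms M : (0 < M)%N -> (m <= M)%N -> (\sum_(M <= k <oo)
    (2 ^- entry_weight k)%:E * size_tail R d (m - k) =
    ((3 / 2) ^+ d * 2 ^- M)%:E)%E.
  move=> M_gt0 m_le; rewrite -nneseries_addn//.
  under eq_eseriesr => i _.
    (* The first entry i + M is nonzero and at least m. *)
    have -> : (m - (i + M))%N = 0%N by lia.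
    have -> : entry_weight (i + M) = (i + M).+1.
      by rewrite /entry_weight; case: eqP; lia.
    rewrite IHd muleC; over.
  rewrite nneseriesZl; last by move=> i _; exact: pow2V_ge0.
  rewrite (@nneseries_addn _ (fun i => (2 ^- i.+1)%:E) M).
    by rewrite nneseries_half_tail EFinM.
  by move=> i; exact: pow2V_ge0.
rewrite size_tailS; case: m => [|N] in term_ge0 far_terms *.
  rewrite (nneseries_split 0%N 1%N)// far_terms// big_nat1 subn0 IHd /=.
  by rewrite -EFinM -EFinD; congr EFin; rewrite expr0 exprS; field.
(* The entry 0 gives the doubled term, the entries 1, ..., N the finite sum, and
   the later ones the power of 3. *)
rewrite (nneseries_split 0%N N.+1)// far_terms// big_nat_recl// subn0 IHd.
rewrite (eq_big_nat _ _ (F2 := fun k =>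
  ((scaled_tail d (N - k.+1))%:R / 2 ^+ (N + d.+1))%:E)); last first.
  move=> k /andP[_ k_lt]; rewrite IHd subSS.
  have -> : (N - k = (N - k.+1).+1)%N by lia.
  rewrite -EFinM; congr EFin.
  rewrite mulrCA -invfM -exprD; congr (_ / 2 ^+ _).
  by rewrite /entry_weight /=; lia.
rewrite sumEFin -EFinM -!EFinD; congr EFin.
rewrite -mulr_suml -natr_sum.
rewrite (_ : (\sum_(0 <= k < N) scaled_tail d (N - k.+1))%N =
             (\sum_(j < N) scaled_tail d j)%N); last first.
  rewrite big_nat_rev/= big_mkord; apply: eq_bigr => j _.
  by congr scaled_tail; have := ltn_ord j; lia.
rewrite scaled_tailS 2!natrD natrM natrX expr0 invr1 mul1r.
rewrite expr_div_n addnS !exprS exprD.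
by field; rewrite !expf_neq0.
Qed.

(** * Expansion in binomial coefficients *)

(** The coefficient of C(N, k) in the rescaled error: the recursion of
    [scaled_tail] doubles it, shifts it by one through the summation over j < N,
    and adds 3^d' to the constant term. *)
Fixpoint tail_coef (d k : nat) : nat :=
  if d is d'.+1 then
    (2 * tail_coef d' k + (if k is k'.+1 then tail_coef d' k' else 3 ^ d'))%N
  else 0%N.

Lemma tail_coefS (d k : nat) :
  tail_coef d.+1 k.+1 = (2 * tail_coef d k.+1 + tail_coef d k)%N.
Proof. by []. Qed.

Lemma tail_coef_small (d k : nat) : (d <= k)%N -> tail_coef d k = 0%N.
Proof.
elim: d k => [//|d IHd] [//|k] d_le /=.
by rewrite !IHd// ltnW.
Qed.

(** The leading coefficient in dimension d + 2 is the shift of the one in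
    dimension d + 1, the doubled part having no term of that degree. *)
Lemma tail_coef_lead (d : nat) : tail_coef d.+1 d = 1%N.
Proof. by elim: d => [//|d IHd]; rewrite tail_coefS tail_coef_small// IHd. Qed.

Lemma sum_bin_col (N k : nat) : (\sum_(j < N) 'C(j, k) = 'C(N, k.+1))%N.
Proof. by elim: N => [|N IHN]; rewrite ?big_ord0// big_ord_recr/= IHN binS. Qed.

(** The summation in the recursion acts on the binomial basis by the hockey-stick
    identity [sum_bin_col]. *)
Lemma scaled_tailE (d N : nat) :
  scaled_tail d N = (\sum_(k < d) tail_coef d k * 'C(N, k))%N.
Proof.
elim: d N => [|d IHd] N; first by rewrite big_ord0.
rewrite scaled_tailS.
under eq_bigr => j _ do rewrite IHd.
rewrite exchange_big/=.
under eq_bigr => k _ do rewrite -big_distrr/= sum_bin_col.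
under [RHS]eq_bigr => k _ do rewrite /= mulnDl -mulnA.
rewrite big_split/= -big_distrr/= big_ord_recr/= tail_coef_small// mul0n addn0.
by rewrite IHd big_ord_recl/= bin0 muln1 -addnA [(3 ^ d + _)%N]addnC.
Qed.

(** * Asymptotics *)

Lemma cvg_invn (R : realType) : (N%:R^-1 : R) @[N --> \oo] --> (0 : R).
Proof. by rewrite -cvg_shiftS; exact: cvg_harmonic. Qed.

(** Induction through (k + 1) C(N, k + 1) = (N - k) C(N, k): each step multiplies
    the quotient by (1 - k / N) / (k + 1). *)
Lemma cvg_bin_pow (R : realType) (k : nat) :
  ('C(N, k)%:R / N%:R ^+ k : R) @[N --> \oo] --> (k`!%:R^-1 : R).
Proof.
elim: k => [|k IHk].
  by under eq_fun do rewrite bin0 expr0 divr1; rewrite invr1; exact: cvg_cst.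
have cvg_ratio : ((1 - k%:R * N%:R^-1) / k.+1%:R : R) @[N --> \oo] -->
    ((1 - k%:R * 0) / k.+1%:R : R).
  apply: cvgM; last exact: cvg_cst.
  by apply: cvgB; [exact: cvg_cst|apply: cvgM; [exact: cvg_cst|exact: cvg_invn]].
rewrite factS natrM invfM mulrC.
have := cvgM IHk cvg_ratio; rewrite mulr0 subr0 mul1r => lim_step.
apply: cvg_trans (lim_step _); apply: near_eq_cvg; near=> N.
have k_lt : (k < N)%N by near: N; exact: nbhs_infty_gt.
have N0 : N%:R != 0 :> R by rewrite pnatr_eq0 -lt0n (leq_trans _ k_lt).
rewrite /=.
have /(congr1 (fun n => n%:R : R)) := mul_bin_left N k.
rewrite !natrM natrB ?(ltnW k_lt)// => bin_rec.
have {bin_rec} -> : 'C(N, k.+1)%:R = (N%:R - k%:R) * 'C(N, k)%:R / k.+1%:R :> R.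
  by rewrite -bin_rec mulrC mulKf ?pnatr_eq0.
by rewrite exprS; field; rewrite expf_neq0 ?N0 -?natr1 ?nat1r ?pnatr_eq0.
Unshelve. all: by end_near. Qed.

(** Starting from the finite limit in degree k, each further division by N
    makes the limit 0. *)
Lemma cvg_bin_pow0 (R : realType) (k d : nat) : (k < d)%N ->
  ('C(N, k)%:R / N%:R ^+ d : R) @[N --> \oo] --> (0 : R).
Proof.
elim: d => [//|d IHd]; rewrite ltnS => k_le.
under eq_fun do rewrite exprSr invfM mulrA.
have [c cvg_c] : exists c : R,
    ('C(N, k)%:R / N%:R ^+ d : R) @[N --> \oo] --> (c : R).
  move: k_le; rewrite leq_eqVlt => /predU1P[<-|/IHd ?]; last by exists 0.
  by exists (k`!%:R^-1); exact: cvg_bin_pow.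
by rewrite -(mulr0 c); apply: cvgM => //; exact: cvg_invn.
Qed.

Lemma cvg_scaled_tail (R : realType) (d : nat) :
  ((scaled_tail d.+1 N)%:R / N%:R ^+ d : R) @[N --> \oo] --> (d`!%:R^-1 : R).
Proof.
have -> : (fun N => (scaled_tail d.+1 N)%:R / N%:R ^+ d : R) =
    (fun N => \sum_(k < d) (tail_coef d.+1 k)%:R * ('C(N, k)%:R / N%:R ^+ d) +
              'C(N, d)%:R / N%:R ^+ d).
  apply/funext => N.
  rewrite scaled_tailE big_ord_recr [tail_coef _ _]tail_coef_lead mul1n.
  rewrite natrD mulrDl natr_sum mulr_suml.
  by under eq_bigr => k _ do rewrite natrM -mulrA.
rewrite -[X in _ --> X]add0r; apply: cvgD; last exact: cvg_bin_pow.
rewrite [X in _ --> X](_ : _ = \sum_(k < d) (tail_coef d.+1 k)%:R * 0); last first.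
  by rewrite big1// => k _; rewrite mulr0.
apply: cvg_big => [|k _]; first exact: add_continuous.
by apply: cvgM; [exact: cvg_cst|exact: cvg_bin_pow0].
Qed.

Theorem lemma4p2 (R : realType) (d : nat) (hd : (1 <= d)%N) :
  (disc_error R N d *
     ((d - 1)`!%:R / (N%:R ^+ (d - 1) * 2 ^- (N + d)))%:E)%E
    @[N --> \oo] --> (1%:E : \bar R).
Proof.
case: d hd => [//|d] _; rewrite subn1 /=.
have -> : (fun N => disc_error R N d.+1 *
      (d`!%:R / (N%:R ^+ d * 2 ^- (N + d.+1)))%:E)%E =
    (fun N => ((scaled_tail d.+1 N)%:R / N%:R ^+ d * d`!%:R : R)%:E).
  apply/funext => N.
  rewrite -[disc_error _ _ _]/(size_tail R d.+1 N.+1) size_tailE -EFinM.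
  congr EFin; set x := 2 ^+ _.
  have x0 : x != 0 by rewrite expf_neq0.
  by rewrite invfM invrK mulrACA [_^-1 * x]mulrC mulKf// mulrAC.
apply: cvg_EFin; first exact: nearW.
rewrite -[X in _ --> X](@mulVf R d`!%:R) ?pnatr_eq0 -?lt0n ?fact_gt0//.
by apply: cvgM; [exact: cvg_scaled_tail|exact: cvg_cst].
Qed.
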